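(* Let $\underline{P}:\mathcal{D}\to\mathbb{R}$ be a lower prevision on a non-empty set $\mathcal{D}$ of conditional gambles, with $L_2$ and $\underline{E}_2$ as defined in the context. Then: a) $L_2(Z|B)$ is non-empty, for every conditional gamble $Z|B$. b) $L_2(Z|B)=\,]-\infty,\underline{E}_2(Z|B)[$, for every conditional gamble $Z|B$. c) If $\underline{P}$ is $1$-AUL, then $\underline{E}_2(Z|B)\leq\sup(Z|B)$ for every conditional gamble $Z|B$. d) If $\underline{P}$ is not $1$-AUL, there exists $Z|B\in\mathcal{D}$ such that $\underline{E}_2(Z|B)=+\infty$.
   Context: Fix a partition $\mathbb{P}$ of the sure event into atoms $\omega$. A gamble is a bounded function $X:\mathbb{P}\to\mathbb{R}$. Events are subsets of $\mathbb{P}$, identified with their indicators; $\vee$ denotes union. For a gamble $X$ and an event $B\neq\varnothing$, the conditional gamble $X|B$ is the restriction of $X$ to $B$; thus $\sup(X|B)=\sup_{\omega\in B}X(\omega)$. $\underline{P}$ is $1$-AUL ($1$-Avoiding Uniform Loss) on $\mathcal{D}$ iff for all $X_0|B_0\in\mathcal{D}$ and all $s_0>0$, $\sup\{s_0B_0(X_0-\underline{P}(X_0|B_0))|B_0\}\geq 0$. For an arbitrary conditional gamble $Z|B$, let $$L_2(Z|B)=\{\alpha\in\mathbb{R}:\sup\{s_1A(X-\underline{P}(X|A))-B(Z-\alpha)|S(\underline{s})\}<0\ \text{for some } X|A\in\mathcal{D},\ s_1\geq 0\},$$ where $S(\underline{s})=A\vee B$ if $s_1>0$ and $S(\underline{s})=B$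 if $s_1=0$. The $2$-coherent natural extension of $\underline{P}$ on $Z|B$ is $\underline{E}_2(Z|B)=\sup L_2(Z|B)\in\,]-\infty,+\infty]$. *)

(* Defs.v *)
From mathcomp Require Import all_boot all_order all_algebra.
From mathcomp Require Import all_classical all_reals all_analysis.
Import Order.TTheory GRing.Theory Num.Theory numFieldNormedType.Exports.

Set Implicit Arguments.
Unset Strict Implicit.
Unset Printing Implicit Defensive.

Local Open Scope classical_set_scope.
Local Open Scope ring_scope.

(* The atoms of the partition are the points of T; events are sets of atoms. *)

(* X|B is literally the restriction to B of a bounded X : T -> R, so that
   gambles agreeing on B define the same conditional gamble X|B. *)
Record cgamble (T : Type) (R : realType) := CGamble {
  cg_event : set T ;
  cg_event_neq0 : cg_event !=set0 ;
  cg_fun : cg_event -> R ;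
  cg_restriction :
    exists2 X : T -> R, bounded_fun X & cg_fun = sigL cg_event X }.
Arguments cg_fun {T R} _ _.

(* The extension by 0 of X|B to all atoms. It is only used multiplied by the
   indicator of B, so the value chosen outside B is immaterial. *)
Definition cg_ext (T : Type) (R : realType) (X : cgamble T R) : T -> R :=
  'valL_0 (cg_fun X).

Definition cg_sup (T : Type) (R : realType) (X : cgamble T R) : R :=
  sup (range (cg_fun X)).

(* The gain B(X - c), as a function on all atoms. *)
Definition cg_gain (T : Type) (R : realType) (X : cgamble T R) (c : R)
    (w : T) : R :=
  \1_(cg_event X) w * (cg_ext X w - c).

(* The suprema below are real-valued `sup's; they are always taken over
   non-empty bounded sets of reals. *)

Definition one_AUL (T : Type) (R : realType) (D : set (cgamble T R))
    (P : D -> R) : Prop :=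
  forall (X0 : D) (s0 : R), 0 < s0 ->
    0 <= sup [set s0 * cg_gain (\val X0) (P X0) w | w in cg_event (\val X0)].

Definition gain_support (T : Type) (R : realType) (s1 : R) (A B : set T) : set T :=
  if 0 < s1 then A `|` B else B.

Definition L2 (T : Type) (R : realType) (D : set (cgamble T R)) (P : D -> R)
    (Z : cgamble T R) : set R :=
  [set alpha : R | exists (X : D) (s1 : R), 0 <= s1 /\
    sup [set s1 * cg_gain (\val X) (P X) w - cg_gain Z alpha w
        | w in gain_support s1 (cg_event (\val X)) (cg_event Z)] < 0].

Definition E2 (T : Type) (R : realType) (D : set (cgamble T R)) (P : D -> R)
    (Z : cgamble T R) : \bar R :=
  ereal_sup [set alpha%:E | alpha in L2 P Z].

(* Main.v *)
(** A supremum is negative exactly when the gains stay below some [-e] with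
    [e > 0]. Membership of [alpha] in [L2] survives lowering [alpha] and, thanks
    to the slack [e], raising it by [e / 2]; hence [L2] is an open lower ray.
    If [alpha > sup (Z|B)], the term [B (Z - alpha)] is nonpositive, so a gain
    witnessing [alpha] in [L2] would be a uniform loss of a single gamble of
    [D]. Conversely a uniform loss on [X0|B0], scaled up, witnesses every
    [alpha] for [Z|B = X0|B0]. *)

Require Import Defs.
From mathcomp Require Import all_boot all_order all_algebra.
From mathcomp Require Import all_classical all_reals all_analysis.
From mathcomp Require Import lra.
Import Order.TTheory GRing.Theory Num.Theory numFieldNormedType.Exports.

Local Open Scope classical_set_scope.
Local Open Scope ring_scope.

Lemma sup_image_lt0P {T : Type} {R : realType} (S : set T) (f : T -> R) :
  S !=set0 ->
  sup [set f w | w in S] < 0 <->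
  exists2 e, 0 < e & forall w, S w -> f w <= - e.
Proof.
move=> [w0 Sw0]; split=> [lt0|[e e0 le_e]].
  exists (- sup [set f w | w in S]); first by rewrite oppr_gt0.
  move=> w Sw; rewrite opprK; apply: ub_le_sup; last by exists w.
  (* [sup] is 0 on a set without a supremum, so a negative value already
     forces boundedness. *)
  have [[]//|/sup_out sup0] := pselect (has_sup [set f w | w in S]).
  by rewrite sup0 ltxx in lt0.
apply: (@le_lt_trans _ _ (- e)); last by rewrite oppr_lt0.
apply: ge_sup; first by exists (f w0), w0.
by move=> _ [w Sw <-]; apply: le_e.
Qed.

Section cgamble_lemmas.
Context {T : Type} {R : realType}.
Implicit Types (Z : cgamble T R) (c : R) (w : T).

Lemma cg_gainE Z c w : cg_event Z w -> cg_gain Z c w = cg_ext Z w - c.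
Proof. by move=> Bw; rewrite /cg_gain indicE mem_set// mul1r. Qed.

Lemma cg_gain_out Z c w : ~ cg_event Z w -> cg_gain Z c w = 0.
Proof. by move=> Bw; rewrite /cg_gain indicE memNset// mul0r. Qed.

Lemma cg_funE Z (u : cg_event Z) : cg_fun Z u = cg_ext Z (\val u).
Proof. by rewrite -[in LHS](valLK 0 (cg_fun Z)). Qed.

Lemma cg_fun_bounded Z : exists M, forall u : cg_event Z, `|cg_fun Z u| <= M.
Proof.
have [X [M [_ bX]] ->] := cg_restriction Z.
(* [bounded_fun] only provides bounds strictly above [M], hence [M + 1]. *)
exists (M + 1) => u; by apply: bX; rewrite ?ltrDl.
Qed.

Lemma cg_ext_bounded Z :
  exists M, forall w, cg_event Z w -> `|cg_ext Z w| <= M.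
Proof.
have [M bZ] := cg_fun_bounded Z.
by exists M => w Bw; have := bZ (SigSub (mem_set Bw)); rewrite cg_funE.
Qed.

Lemma cg_ext_le_sup Z w : cg_event Z w -> cg_ext Z w <= cg_sup Z.
Proof.
move=> Bw; have [M bZ] := cg_fun_bounded Z.
apply: ub_le_sup; last by exists (SigSub (mem_set Bw)) => //; rewrite cg_funE.
by exists M => _ [u _ <-]; apply: le_trans (ler_norm _) (bZ u).
Qed.

Lemma gain_support_event (s : R) (A B : set T) w : B w -> gain_support s A B w.
Proof. by rewrite /gain_support; case: ifP => //= _ Bw; right. Qed.

End cgamble_lemmas.

Section natural_extension.
Context {T : Type} {R : realType} {D : set (cgamble T R)} {P : D -> R}.
Implicit Type Z : cgamble T R.

(** Trades the supremum for a pointwise bound with explicit slack [e]; the support is non-empty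
    because it always contains the event of [Z]. *)
Lemma L2P Z alpha : L2 P Z alpha <->
  exists (X : D) (s e : R), [/\ 0 <= s, 0 < e &
    forall w, gain_support s (cg_event (\val X)) (cg_event Z) w ->
      s * cg_gain (\val X) (P X) w - cg_gain Z alpha w <= - e].
Proof.
have ne X s : gain_support s (cg_event (\val X : cgamble T R)) (cg_event Z)
    !=set0.
  by have [w Bw] := cg_event_neq0 Z; exists w; apply: gain_support_event.
split=> [[X [s [s0 /sup_image_lt0P[]// e e0 he]]]|[X [s [e [s0 e0 he]]]]].
  by exists X, s, e.
by exists X, s; split=> //; apply/sup_image_lt0P => //; exists e.
Qed.

Lemma L2_nonempty Z : D !=set0 -> L2 P Z !=set0.
Proof.
move=> [X DX]; have [M bZ] := cg_ext_bounded Z.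
(* At stake 0 the support is the event of [Z], and the condition reads [alpha <= Z - 1] there. *)
exists (- M - 1); apply/L2P; exists (SigSub (mem_set DX)), 0, 1.
split=> // w; rewrite /gain_support ltxx => Bw.
rewrite mul0r cg_gainE//; have := bZ _ Bw; rewrite ler_norml => /andP[? _].
lra.
Qed.

(** The same [X], [s] and [e] serve: lowering the price raises the gain on the event of [Z] and
    leaves it 0 elsewhere. *)
Lemma L2_le Z alpha beta : alpha <= beta -> L2 P Z beta -> L2 P Z alpha.
Proof.
move=> ab /L2P[X [s [e [s0 e0 he]]]]; apply/L2P; exists X, s, e; split=> // w Sw.
have {he} := he _ Sw; have [Bw|nBw] := pselect (cg_event Z w).
  rewrite !(cg_gainE Z)//; lra.
by rewrite !(cg_gain_out Z).
Qed.

Lemma L2_gt Z alpha : L2 P Z alpha -> exists2 beta, alpha < beta & L2 P Z beta.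
Proof.
move=> /L2P[X [s [e [s0 e0 he]]]]; exists (alpha + e / 2); first lra.
apply/L2P; exists X, s, (e / 2); split=> //; first lra.
move=> w Sw; have {he} := he _ Sw.
have [Bw|nBw] := pselect (cg_event Z w).
  rewrite !(cg_gainE Z)//; lra.
rewrite !(cg_gain_out Z)//; lra.
Qed.

Lemma L2E Z : L2 P Z = [set alpha : R | (alpha%:E < E2 P Z)%E].
Proof.
apply/seteqP; split=> alpha /=.
  move=> /L2_gt[beta ab Lb]; apply: (@lt_le_trans _ _ beta%:E).
    by rewrite lte_fin.
  by apply: ereal_sup_ubound; exists beta.
move=> /ereal_sup_gt[_ [beta Lb <-]]; rewrite lte_fin => /ltW ab.
exact: L2_le Lb.
Qed.

Lemma one_AUL_le_sup Z : one_AUL P -> (E2 P Z <= (cg_sup Z)%:E)%E.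
Proof.
move=> AUL; apply: ge_ereal_sup => _ [alpha /L2P[X [s [e [s0 e0 he]]]] <-].
rewrite lee_fin leNgt; apply/negP => lt_alpha.
have gainZ_le0 w : cg_gain Z alpha w <= 0.
  have [Bw|nBw] := pselect (cg_event Z w); last by rewrite cg_gain_out.
  by rewrite cg_gainE//; have := cg_ext_le_sup _ _ Bw; lra.
(* A zero stake leaves only [- cg_gain Z alpha], which is nonnegative and so cannot be at most
   [- e]. A positive stake puts the whole event of [X] in the support, which gives the uniform
   loss. *)
move: s0; rewrite le_eqVlt => /predU1P[s0|s_gt0].
  have [w Bw] := cg_event_neq0 Z.
  have := he w (gain_support_event _ _ _ _ Bw).
  by rewrite -s0 mul0r; have := gainZ_le0 w; lra.
have := AUL X _ s_gt0; rewrite leNgt => /negP; apply.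
apply/sup_image_lt0P; first exact: cg_event_neq0.
exists e => // w Aw; have := he w; rewrite /gain_support s_gt0.
by move=> /(_ (or_introl Aw)); have := gainZ_le0 w; lra.
Qed.

Lemma not_one_AUL_infty :
  ~ one_AUL P -> exists Z : cgamble T R, D Z /\ E2 P Z = +oo%E.
Proof.
move=> /existsNP[X /existsNP[s /not_implyP[s0 /negP]]].
rewrite -ltNge => /sup_image_lt0P[]; first exact: cg_event_neq0.
move=> e e0 he; exists (\val X); split; first exact: set_valP.
have [M bX] := cg_ext_bounded (\val X).
suff L2X alpha : L2 P (\val X) alpha.
  apply/eqyP => r _; apply: ereal_sup_ubound; exists r => //.
(* A uniform loss of [e] at stake [s] becomes a loss of [k * e] at stake
   [k * s], which absorbs the bounded gain [X - alpha]. *)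
pose k := (`|M| + `|alpha| + 1) / e.
have k_gt0 : 0 < k.
  by rewrite divr_gt0// ltr_wpDl// addr_ge0.
have ke : k * e = `|M| + `|alpha| + 1 by rewrite divfK// gt_eqF.
apply/L2P; exists X, (k * s), 1; split=> //; first by rewrite mulr_ge0// ltW.
(* Both gambles live on the same event, so the support is that event whatever the stake. *)
move=> w; rewrite /gain_support setUid if_same => Aw.
rewrite -mulrA (cg_gainE _ alpha _ Aw).
(* Since [alpha - X] is at most [|alpha| + |M|], the scaled loss leaves a slack of 1. *)
have := ler_wpM2l (ltW k_gt0) (he _ Aw); rewrite mulrN ke.
have := bX _ Aw; rewrite ler_norml => /andP[? _].
by have := ler_norm M; have := ler_norm alpha; lra.
Qed.

End natural_extension.

Theorem proposition12 (T : Type) (R : realType) (D : set (cgamble T R))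
    (P : D -> R) (hD : D !=set0) :
  [/\ forall Z : cgamble T R, L2 P Z !=set0,
      forall Z : cgamble T R,
        L2 P Z = [set alpha : R | (alpha%:E < E2 P Z)%E],
      one_AUL P ->
        forall Z : cgamble T R, (E2 P Z <= (cg_sup Z)%:E)%E
    & ~ one_AUL P -> exists Z : cgamble T R, D Z /\ E2 P Z = +oo%E].
Proof.
split.
- by move=> Z; apply: L2_nonempty.
- exact: L2E.
- by move=> AUL Z; apply: one_AUL_le_sup.
- exact: not_one_AUL_infty.
Qed.
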